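(* A subset $S\subset\mathbb{Z}^n$ is realizable if and only if the following three properties hold: (1) if $x\in S$, then $x_i\ge 0$ for every $i\in\{1,\dots,n\}$, and $x$ has at most one coordinate equal to zero; (2) for every $i\in\{1,\dots,n\}$ there exists exactly one element $x\in S$ with $x_i=0$; (3) if $x\in S$ and $x_i>0$ for some $i\in\{1,\dots,n\}$, then there exists $y\in S$ with $y_i=x_i-1$ and $\max_{j\in\{1,\dots,n\}}\vert y_j-x_j\vert\le 1$.
   Context: All graphs are finite, simple and connected; $d$ is the shortest-path distance. For $x\in\mathbb{Z}^n$, $x_i$ is its $i$-th coordinate. For an ordered vertex subset $W=(\omega_1,\dots,\omega_n)$ of $G$, $r(u\vert W)=(d(u,\omega_1),\dots,d(u,\omega_n))$. $W$ is a resolving set if $r(u\vert W)\ne r(v\vert W)$ for all distinct $u,v\in V(G)$. A finite subset $S\subset\mathbb{Z}^n$ is realizable if there exist a graph $G$ and a resolving set $W$ of $G$ (with $n$ elements) such that $S=\{r(u\vert W)\colon u\in V(G)\}$. *)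

(* Defs.v *)
From HB Require Import structures.
From mathcomp Require Import all_boot all_order all_algebra.
From mathcomp Require Import finmap.

Set Implicit Arguments.
Unset Strict Implicit.
Unset Printing Implicit Defensive.

Import Order.TTheory GRing.Theory Num.Theory.
Local Open Scope ring_scope.

Record graph := Graph {
  vertex :> finType;
  adj : rel vertex;
  adj_sym : symmetric adj;
  adj_irrefl : irreflexive adj;
  graph_nonempty : (0 < #|vertex|)%N;
  graph_connected : forall u v : vertex, connect adj u v
}.

(* [p] lists the vertices of the walk after its origin [u], so its size is the
   number of edges. *)
Definition has_walk (G : graph) (u v : G) (k : nat) : bool :=
  [exists p : k.-tuple G, path (@adj G) u p && (last u p == v)].

Lemma has_walk_ex (G : graph) (u v : G) : exists k, has_walk u v k.
Proof.
have /connectP[p up ->] := graph_connected u v.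
by exists (size p); apply/existsP; exists (in_tuple p); rewrite up eqxx.
Qed.

Definition dist (G : graph) (u v : G) : nat := ex_minn (has_walk_ex u v).

Definition repr_vec (G : graph) (n : nat) (W : n.-tuple G) (u : G) :
    'rV[int]_n :=
  \row_(i < n) (dist u (tnth W i))%:Z.

Definition resolving (G : graph) (n : nat) (W : n.-tuple G) : Prop :=
  forall u v : G, u != v -> repr_vec W u != repr_vec W v.

(* [uniq W]: an ordered vertex subset has no repeated entries. *)
Definition realizable (n : nat) (S : {fset 'rV[int]_n}) : Prop :=
  exists (G : graph) (W : n.-tuple G),
    [/\ uniq W, resolving W & S = [fset repr_vec W u | u in G]%fset].

(* Main.v *)
(* Neighbouring vertices have metric representations differing by at most one in
   each coordinate, and a vertex other than a landmark has a neighbour one step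
   closer to it: this gives necessity.  Conversely, join two distinct points of
   S when they are at sup-distance 1.  Coordinate i is then 1-Lipschitz along
   edges, vanishes only at the i-th landmark and, by (3), can be decreased by
   one along some edge elsewhere; hence it is the distance to that landmark. *)
Require Import Defs.
From HB Require Import structures.
From mathcomp Require Import all_boot all_order all_algebra.
From mathcomp Require Import finmap zify.

Set Implicit Arguments.
Unset Strict Implicit.
Unset Printing Implicit Defensive.

Import Order.TTheory GRing.Theory Num.Theory.
Local Open Scope ring_scope.

Section Distance.

Variable G : graph.
Implicit Types u v w : G.

Lemma dist_le_size u (p : seq G) :
  path (@adj G) u p -> (dist u (last u p) <= size p)%N.
Proof.
move=> up; rewrite /dist; case: ex_minnP => m _; apply.
by apply/existsP; exists (in_tuple p); rewrite up eqxx.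
Qed.

Lemma geodesic u v :
  exists p, [/\ path (@adj G) u p, last u p = v & size p = dist u v].
Proof.
rewrite /dist; case: ex_minnP => m /existsP[p /andP[up /eqP pv]] _.
by exists p; rewrite size_tuple.
Qed.

Lemma dist_eq0 u v : (dist u v == 0)%N = (u == v).
Proof.
apply/eqP/eqP => [duv0 | <-]; last first.
  by apply/eqP; rewrite -leqn0; apply: (@dist_le_size u [::]).
by have [[|w p] [_ pv]] := geodesic u v; rewrite duv0.
Qed.

Lemma dist_adj u v w : adj u v -> (dist u w <= (dist v w).+1)%N.
Proof.
have [p [vp <- <-]] := geodesic v w => uv.
by apply: (@dist_le_size u (v :: p)); rewrite /= uv.
Qed.

(** The second vertex of a geodesic works: the remaining tail is a walk to [w] one edge shorter, and
    [dist_adj] rules out a larger drop. *)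
Lemma dist_descent u w :
  (0 < dist u w)%N -> exists2 v, adj u v & (dist v w).+1 = dist u w.
Proof.
have [[|v p] /= [up pw sp]] := geodesic u w; first by rewrite -sp.
case/andP: up => uv vp _; exists v => //; apply/eqP.
by rewrite eqn_leq dist_adj // -sp -pw ltnS dist_le_size.
Qed.

End Distance.

(** Stated for a bare relation because it also proves the constructed graph connected, before any
    distance exists on it. *)
Lemma descending_path (T : Type) (e : rel T) (f : T -> nat) (w : T) :
    (forall u, f u = 0%N -> u = w) ->
    (forall u, (0 < f u)%N -> exists2 v, e u v & (f v).+1 = f u) ->
  forall u, exists p, [/\ path e u p, last u p = w & size p = f u].
Proof.
move=> f0 fS u; move fu: (f u) => k; elim: k u fu => [|k IHk] u fu.
  by exists [::]; split=> //; apply: f0.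
have [|v uv fv] := fS u; first by rewrite fu.
have [|p [vp pw sp]] := IHk v; first by move: fv; rewrite fu => -[].
by exists (v :: p); rewrite /= uv sp.
Qed.

Lemma lipschitz_path (T : Type) (e : rel T) (f : T -> nat) :
    (forall u v, e u v -> (f u <= (f v).+1)%N) ->
  forall u p, path e u p -> (f u <= size p + f (last u p))%N.
Proof.
move=> fL u p; elim: p u => //= v p IHp u /andP[/fL uv /IHp].
by rewrite addSn -ltnS; apply: leq_trans.
Qed.

(** Descending along [f] traces a walk of length [f u] to [w], whence the upper bound. Along a
    geodesic [f] drops by at most one per edge and ends at 0, whence the lower bound. *)
Lemma dist_characterization (G : graph) (f : G -> nat) (w : G) :
    (forall u, f u = 0%N <-> u = w) ->
    (forall u v, adj u v -> (f u <= (f v).+1)%N) ->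
    (forall u, (0 < f u)%N -> exists2 v, adj u v & (f v).+1 = f u) ->
  forall u, dist u w = f u.
Proof.
move=> f0 fL fS u; apply/eqP; rewrite eqn_leq; apply/andP; split.
  have [p [up <- <-]] := descending_path (fun v => (f0 v).1) fS u.
  exact: dist_le_size.
have [p [up pw <-]] := geodesic u w.
have := lipschitz_path fL up; rewrite pw.
by have /f0 -> : w = w by []; rewrite addn0.
Qed.

Lemma absz_subz_le1 (a b : nat) :
  (absz (a%:Z - b%:Z)%R <= 1)%N = (a <= b.+1)%N && (b <= a.+1)%N.
Proof. lia. Qed.

Lemma bigmax_absz_le1 (n : nat) (x y : 'rV[int]_n) :
  (\max_(j < n) absz (y 0 j - x 0 j)%R <= 1)%N <->
  forall j, (absz (y 0 j - x 0 j)%R <= 1)%N.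
Proof. by split=> [/bigmax_leqP H j | H]; [apply: H | apply/bigmax_leqP]. Qed.

Section RealizableNecessary.

Variables (G : graph) (n : nat) (W : n.-tuple G).

Lemma repr_vec_eq0 (u : G) i : (repr_vec W u 0 i == 0) = (u == tnth W i).
Proof. by rewrite mxE -dist_eq0. Qed.

(** Each zero coordinate identifies [u] with a landmark, so two of them would repeat an entry of
    [W]. *)
Lemma repr_vec_zeros (u : G) : uniq W ->
  (#|[set i : 'I_n | (repr_vec W u 0 i == 0)%R]| <= 1)%N.
Proof.
move=> /tuple_uniqP W_inj.
apply/card_le1_eqP => i j; rewrite !inE !repr_vec_eq0 => /eqP ui /eqP uj.
by apply: W_inj; rewrite -ui -uj.
Qed.

Lemma repr_vec_descent (u : G) i : 0 < repr_vec W u 0 i ->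
  exists v : G, repr_vec W v 0 i = repr_vec W u 0 i - 1 /\
    (\max_(j < n) absz (repr_vec W v 0 j - repr_vec W u 0 j)%R <= 1)%N.
Proof.
rewrite mxE => /dist_descent[v uv dv]; exists v; split.
  by rewrite !mxE; lia.
apply/bigmax_absz_le1 => j; rewrite !mxE absz_subz_le1.
(* The edge is read in both directions to bound the absolute difference. *)
by rewrite !dist_adj // adj_sym.
Qed.

End RealizableNecessary.

Section RealizableSufficient.

Variables (n : nat) (S : {fset 'rV[int]_n}).
Hypothesis n_gt0 : (0 < n)%N.
Hypothesis S_ge0 : forall x : 'rV[int]_n, x \in S -> forall i, 0 <= x 0 i.
Hypothesis S_zeros : forall x : 'rV[int]_n, x \in S ->
  (#|[set i : 'I_n | (x 0 i == 0)%R]| <= 1)%N.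
Hypothesis S_landmark : forall i : 'I_n, exists! x : 'rV[int]_n, x \in S /\ x 0 i = 0.
Hypothesis S_descent : forall (x : 'rV[int]_n) (i : 'I_n), x \in S -> 0 < x 0 i ->
  exists y : 'rV[int]_n, [/\ y \in S, y 0 i = x 0 i - 1
    & (\max_(j < n) absz (y 0 j - x 0 j)%R <= 1)%N].

(** A move of a chess king in dimension [n]: between distinct integer points, differences of at most
    1 mean sup-distance exactly 1. *)
Definition king_adj (x y : S) : bool :=
  (x != y) && [forall j, (absz (fsval x 0 j - fsval y 0 j)%R <= 1)%N].

Lemma king_adj_sym : symmetric king_adj.
Proof.
by move=> x y; rewrite /king_adj eq_sym; under eq_forallb do rewrite distnC.
Qed.

Lemma king_adj_irrefl : irreflexive king_adj.
Proof. by move=> x; rewrite /king_adj eqxx. Qed.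

Lemma landmark_ex (i : 'I_n) : exists x : S, fsval x 0 i == 0.
Proof. by have [x [[xS xi] _]] := S_landmark i; exists [` xS]%fset; apply/eqP. Qed.

Definition landmark (i : 'I_n) : S := xchoose (landmark_ex i).

(** The uniqueness in [S_landmark] makes the choice behind [landmark] immaterial. *)
Lemma coord_eq0 (x : S) (i : 'I_n) : absz (fsval x 0 i) = 0%N <-> x = landmark i.
Proof.
have /eqP wi : fsval (landmark i) 0 i == 0 := xchooseP (landmark_ex i).
split=> [/eqP | ->]; last by rewrite wi.
rewrite absz_eq0 => /eqP xi; apply: val_inj.
have [z [_ zP]] := S_landmark i.
apply: (etrans (y := z)); [symmetry|]; apply: zP; split=> //; exact: fsvalP.
Qed.

Lemma king_adj_lipschitz (i : 'I_n) (x y : S) :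
  king_adj x y -> (absz (fsval x 0%R i) <= (absz (fsval y 0%R i)).+1)%N.
Proof. by case/andP=> _ /forallP/(_ i); lia. Qed.

Lemma king_adj_descent (i : 'I_n) (x : S) : (0 < absz (fsval x 0%R i))%N ->
  exists2 y : S, king_adj x y & (absz (fsval y 0%R i)).+1 = absz (fsval x 0%R i).
Proof.
rewrite absz_gt0 => xi_neq0; have x_ge0 := S_ge0 (fsvalP x) i.
have [|y [yS yi /bigmax_absz_le1 yx]] := S_descent (i := i) (fsvalP x).
  by rewrite lt0r xi_neq0.
have yx_coord : (absz (y 0%R i)).+1 = absz (fsval x 0%R i).
  by have := S_ge0 yS i; rewrite yi; move: (fsval x 0 i) x_ge0 => c; lia.
exists [` yS]%fset => //; apply/andP; split.
  by apply/eqP => xy; move: yx_coord; rewrite xy => /eqP; rewrite eqn_leq ltnn.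
by apply/forallP => j; rewrite distnC.
Qed.

Lemma king_adj_connected (x y : S) : connect king_adj x y.
Proof.
pose w := landmark (Ordinal n_gt0).
have to_w z : connect king_adj z w.
  have [p [zp pw _]] := descending_path (fun u => (coord_eq0 u _).1)
    (@king_adj_descent (Ordinal n_gt0)) z.
  by apply/connectP; exists p.
apply: connect_trans (to_w x) _.
by rewrite (sym_connect_sym king_adj_sym) to_w.
Qed.

(** Here [n_gt0] matters: for [n = 0] an empty [S] would meet the other hypotheses, yet graphs are
    nonempty. *)
Lemma king_nonempty : (0 < #|{: S}|)%N.
Proof. by apply/card_gt0P; exists (landmark (Ordinal n_gt0)). Qed.

Definition king_graph : graph :=
  Graph king_adj_sym king_adj_irrefl king_nonempty king_adj_connected.

Definition landmarks : n.-tuple king_graph := [tuple landmark i | i < n].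

Lemma repr_vec_landmarks (x : S) :
  repr_vec landmarks (x : king_graph) = fsval x.
Proof.
apply/rowP => i; rewrite mxE tnth_mktuple.
(* Distances are natural numbers, so the coordinate passes through [absz]; by [S_ge0] this loses
   nothing. *)
rewrite (@dist_characterization king_graph (fun y : S => absz (fsval y 0 i))).
- by rewrite gez0_abs // S_ge0 // (fsvalP x).
- by move=> u; apply: coord_eq0.
- exact: king_adj_lipschitz.
- exact: king_adj_descent.
Qed.

(** A point serving as landmark for both [i] and [j] vanishes at both coordinates, so [S_zeros]
    forces [i = j]. *)
Lemma landmarks_uniq : uniq landmarks.
Proof.
apply/tuple_uniqP => i j; rewrite !tnth_mktuple => wij.
have /card_le1_eqP := S_zeros (fsvalP (landmark i)).
apply; rewrite inE -absz_eq0; apply/eqP.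
  by apply/coord_eq0.
by apply/coord_eq0.
Qed.

Lemma king_realizable : realizable S.
Proof.
exists king_graph, landmarks; split; first exact: landmarks_uniq.
  (* Each vertex is its own metric representation, so resolving is injectivity of the inclusion of
     [S]. *)
  by move=> u v; rewrite !repr_vec_landmarks (inj_eq val_inj).
apply/fsetP => x; apply/idP/imfsetP => [xS | [u _ ->]].
  by exists [` xS]%fset; rewrite // repr_vec_landmarks.
by rewrite repr_vec_landmarks (fsvalP u).
Qed.

End RealizableSufficient.

Theorem theorem3 (n : nat) (hn : (0 < n)%N) (S : {fset 'rV[int]_n}) :
  realizable S <->
  [/\ forall x : 'rV[int]_n, x \in S ->
        (forall i : 'I_n, 0 <= x 0 i) /\ (#|[set i : 'I_n | (x 0 i == 0)%R]| <= 1)%N,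
      forall i : 'I_n, exists! x : 'rV[int]_n, x \in S /\ x 0 i = 0
    & forall (x : 'rV[int]_n) (i : 'I_n), x \in S -> 0 < x 0 i ->
        exists y : 'rV[int]_n,
          [/\ y \in S, y 0 i = x 0 i - 1
            & (\max_(j < n) absz (y 0 j - x 0 j)%R <= 1)%N]].
Proof.
split=> [[G [W [W_uniq _ S_def]]] | [S1 S2 S3]]; last first.
  by apply: king_realizable => // x /S1[].
have inS u : repr_vec W u \in S by rewrite S_def; apply/imfsetP; exists u.
have Sin x : x \in S -> exists u, x = repr_vec W u.
  by rewrite S_def => /imfsetP[u _ ->]; exists u.
split=> [_ /Sin[u ->] | i | _ i /Sin[u ->]].
- by split=> [i|]; [rewrite mxE | apply: repr_vec_zeros].
- exists (repr_vec W (tnth W i)); split.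
    by split=> //; apply/eqP; rewrite repr_vec_eq0.
  (* A vanishing coordinate [i] means distance zero, so [v] is the landmark itself. *)
  by move=> _ [/Sin[v ->] /eqP]; rewrite repr_vec_eq0 => /eqP->.
- by case/repr_vec_descent => v [vi vu]; exists (repr_vec W v).
Qed.
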